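(* Let $\mathcal{S}$ be (the block set of) a Steiner system $\mathrm{S}(t,k,n)$ on the point set $\mathbb{Z}_n$, with $t\ge 1$, and let $\{\mathcal{T}_1,\mathcal{T}_2,\ldots,\mathcal{T}_r\}$ be a partition of the blocks of $\mathcal{S}$ into $r$ Steiner systems, where each $\mathcal{T}_j$ is a Steiner system $\mathrm{S}(t-1,k,n)$ on $\mathbb{Z}_n$. Let $\mathcal{S}'$ be the set of words over $\mathbb{Z}_2^n\times\mathbb{Z}_{r+1}$ obtained by taking, for each $j$ with $1\le j\le r$ and each block $\{x_1,\ldots,x_k\}\in\mathcal{T}_j$, the word that has ones exactly in the positions of the first $n$ (binary) coordinates indexed by $x_1,\ldots,x_k$ and has the letter $j$ in the last coordinate. Then $\mathcal{S}'$ is a mixed Steiner system $\mathrm{MS}(t,k+1,\mathbb{Z}_2^n\times\mathbb{Z}_{r+1})$.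
   Context: A Steiner system $\mathrm{S}(t,k,n)$ is a collection of $k$-subsets (blocks) of an $n$-set such that each $t$-subset of the $n$-set is contained in exactly one block. The first $n$ coordinates of $\mathbb{Z}_2^n\times\mathbb{Z}_{r+1}$ are indexed by the points of $\mathbb{Z}_n$. For integers $q_1,\dots,q_N\ge 2$ let $Q=\mathbb{Z}_{q_1}\times\cdots\times\mathbb{Z}_{q_N}$, viewed as the set of words of length $N$ whose $i$-th letter lies in $\mathbb{Z}_{q_i}$. The weight of a word is its number of nonzero coordinates, and $d(\cdot,\cdot)$ is the Hamming distance. For integers $1\le t\le k\le N$, a mixed Steiner system $\mathrm{MS}(t,k,Q)$ is a set $\mathcal{C}$ of words of $Q$ of weight $k$ such that (i) for every word $x\in Q$ of weight $t$ there is exactly one $c\in\mathcal{C}$ with $d(x,c)=k-t$; and (ii) any two distinct elements of $\mathcal{C}$ are at Hamming distance at least $2(k-t)+1$. *)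

(* Defs.v *)
From mathcomp Require Import all_boot all_order all_algebra.

Set Implicit Arguments.
Unset Strict Implicit.
Unset Printing Implicit Defensive.

Import GRing.Theory.

(* Points are 'I_n rather than 'Z_n: only the underlying n-set matters, and
   'Z_n has two elements when n = 1. *)
Definition steiner_system (t k n : nat) (S : {set {set 'I_n}}) : Prop :=
  (forall B : {set 'I_n}, B \in S -> #|B| = k) /\
  (forall A : {set 'I_n}, #|A| = t ->
     exists! B : {set 'I_n}, B \in S /\ A \subset B).

(* 'Z_(q i) is the ring of integers mod q i only for q i >= 2; this is imposed
   by ms_alphabet. *)
Notation word q := {dffun forall i, 'Z_(q i)}.

Definition weight (N : nat) (q : 'I_N -> nat) (x : word q) : nat :=
  #|[set i : 'I_N | x i != 0%R]|.

Definition hamming (N : nat) (q : 'I_N -> nat) (x y : word q) : nat :=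
  #|[set i : 'I_N | x i != y i]|.

Record mixed_steiner_system (t k N : nat) (q : 'I_N -> nat)
    (C : {set word q}) : Prop := MixedSteinerSystem {
  ms_alphabet : forall i : 'I_N, 2 <= q i;
  ms_params   : 1 <= t <= k /\ k <= N;
  ms_weight   : forall c : word q, c \in C -> weight c = k;
  ms_cover    : forall x : word q, weight x = t ->
                  exists! c : word q, c \in C /\ hamming x c = k - t;
  ms_dist     : forall c c' : word q, c \in C -> c' \in C -> c <> c' ->
                  2 * (k - t) + 1 <= hamming c c'
}.

(* Alphabet sizes of Z_2^n x Z_(r+1). *)
Definition bin_ext (n r : nat) (i : 'I_(n + 1)) : nat :=
  match split i with inl _ => 2 | inr _ => r.+1 end.

Definition block_letter (n : nat) (B : {set 'I_n}) (a : nat)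
    (i : 'I_(n + 1)) : nat :=
  match split i with inl p => p \in B | inr _ => a end.

Definition block_word (n r : nat) (B : {set 'I_n}) (a : nat) :
    word (@bin_ext n r) :=
  [ffun i : 'I_(n + 1) => (block_letter B a i)%:R%R : 'Z_(bin_ext r i)].

(* The indices j : 'I_r run over 0, ..., r - 1, so the part T j carries the
   nonzero letter j + 1. *)
Definition extended_words (n r : nat) (T : 'I_r -> {set {set 'I_n}}) :
    {set word (@bin_ext n r)} :=
  \bigcup_(j < r) [set block_word r B j.+1 | B in T j].

(* Main.v *)
(** A word of Z_2^n x Z_(r+1) amounts to a subset of the points together with a
    last letter, so Hamming distances reduce to symmetric differences of
    subsets plus the comparison of the last letters.  A word of weight [t] with
    last letter 0 is a [t]-set, covered through the S(t,k,n); one with last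
    letter [j <> 0] is a [(t-1)]-set, covered through the S(t-1,k,n) carrying
    [j].  Blocks of one part meet in at most [t-2] points; blocks of distinct
    parts meet in at most [t-1] points, and there the last letter contributes
    the missing unit of distance. *)
Require Import Defs.
From mathcomp Require Import all_boot all_order all_algebra zify.

Lemma exists_subset_card (U : finType) (X : {set U}) (m : nat) :
  m <= #|X| -> exists2 A : {set U}, A \subset X & #|A| = m.
Proof.
case/card_geqP=> s [us <- sX]; exists [set x in s].
  by apply/subsetP=> x; rewrite inE => /sX.
by rewrite cardsE; apply/card_uniqP.
Qed.

Lemma card_set_split (n : nat) (P : pred 'I_(n + 1)) :
  #|[set i | P i]| = #|[set p : 'I_n | P (lshift 1 p)]| + P (rshift n ord0).
Proof.
rewrite -!sum1dep_card [LHS]big_mkcond big_split_ord big_ord1 -big_mkcond /=.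
by case: (P (rshift n ord0)).
Qed.

(** Turns a distance between supports into the size of an intersection; the additive form avoids
    truncated subtraction. *)
Lemma card_symdiff (U : finType) (A B : {set U}) :
  #|A :\: B| + #|B :\: A| + 2 * #|A :&: B| = #|A| + #|B|.
Proof.
by have := cardsID B A; have := cardsID A B; rewrite [B :&: A]setIC; lia.
Qed.

(** If the intersection had [t] points, some [t]-subset of it would lie in two distinct blocks. *)
Lemma steiner_meet (t k n : nat) (S : {set {set 'I_n}}) (B C : {set 'I_n}) :
  steiner_system t k S -> B \in S -> C \in S -> B <> C -> #|B :&: C| < t.
Proof.
move=> [_ cov] BS CS neq; rewrite ltnNge; apply/negP.
case/exists_subset_card=> A; rewrite subsetI => /andP[AB AC] /cov[D [_ uD]].
by apply: neq; rewrite -(uD B) // -(uD C).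
Qed.

Lemma split_lshift (m n : nat) (i : 'I_m) : split (lshift n i) = inl i.
Proof. exact: (unsplitK (inl i)). Qed.

Lemma split_rshift (m n : nat) (i : 'I_n) : split (rshift m i) = inr i.
Proof. exact: (unsplitK (inr i)). Qed.

Definition supp {n r : nat} (x : word (@bin_ext n r)) : {set 'I_n} :=
  [set p | x (lshift 1 p) != 0%R].

(** Taken in [nat], because the alphabet [bin_ext r (rshift n ord0)] does not reduce to [r.+1]. *)
Definition letter {n r : nat} (x : word (@bin_ext n r)) : nat :=
  x (rshift n ord0).

Lemma bin_ext_lshift (n r : nat) (p : 'I_n) : bin_ext r (lshift 1 p) = 2.
Proof. by rewrite /bin_ext split_lshift. Qed.

Lemma bin_ext_rshift (n r : nat) (i : 'I_1) : bin_ext r (rshift n i) = r.+1.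
Proof. by rewrite /bin_ext split_rshift. Qed.

Section Words.
Variables n r : nat.
Implicit Types x y : word (@bin_ext n r).

Lemma bitE x (p : 'I_n) : x (lshift 1 p) = (p \in supp x) :> nat.
Proof.
rewrite inE -val_eqE /=; have := ltn_ord (x (lshift 1 p)).
by rewrite {2}bin_ext_lshift; case: (nat_of_ord _) => [|[]].
Qed.

Lemma weightE x : weight x = #|supp x| + (letter x != 0).
Proof. by rewrite /weight card_set_split. Qed.

Lemma hammingE x y : hamming x y =
  #|supp x :\: supp y| + #|supp y :\: supp x| + (letter x != letter y).
Proof.
rewrite /hamming card_set_split -val_eqE; congr (_ + _).
have dis : [disjoint supp x :\: supp y & supp y :\: supp x].
  by rewrite -setI_eq0; apply/eqP/setP=> p; rewrite !inE; do 2!case: eqP.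
rewrite -cardsUI (eqP (etrans (setI_eq0 _ _) dis)) cards0 addn0.
congr #|pred_of_set _|; apply/setP=> p.
rewrite in_setU !in_setD [LHS]in_set -val_eqE /= !bitE.
by case: (p \in supp x); case: (p \in supp y).
Qed.

Hypothesis r_gt0 : 0 < r.

(** Positivity of [r] matters: ['Z_1] has two elements, so for [r = 0] the value 1 would occur. *)
Lemma letter_le x : letter x <= r.
Proof.
have := ltn_ord (x (rshift n ord0)).
by rewrite -/(letter x) bin_ext_rshift Zp_cast.
Qed.

Lemma supp_block_word (B : {set 'I_n}) (a : nat) : supp (block_word r B a) = B.
Proof.
apply/setP=> p; rewrite inE -val_eqE /= ffunE val_Zp_nat bin_ext_lshift //.
by rewrite /block_letter split_lshift; case: (p \in B).
Qed.

Lemma letter_block_word (B : {set 'I_n}) (a : nat) :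
  a <= r -> letter (block_word r B a) = a.
Proof.
move=> ar; rewrite /letter ffunE val_Zp_nat bin_ext_rshift //.
by rewrite /block_letter split_rshift modn_small.
Qed.

End Words.

Lemma extended_wordsP (n r : nat) (T : 'I_r -> {set {set 'I_n}})
    (c : word (@bin_ext n r)) :
  reflect (exists (j : 'I_r) (B : {set 'I_n}),
             B \in T j /\ c = block_word r B j.+1)
          (c \in extended_words T).
Proof.
apply: (iffP bigcupP) => [[j _ /imsetP[B BT ->]]|[j [B [BT ->]]]].
  by exists j, B.
by exists j => //; apply: imset_f.
Qed.

(** Let [d] points of [supp x] lie outside [B]. The distance is [k + 1 - t + 2 * d] if the letter of
    [x] is 0, since then [supp x] has [t] points. Otherwise [supp x] has [t - 1] points and the
    distance is the same number, plus 1 if the letters differ. *)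
Lemma hamming_block_word (n r k t : nat) (x : word (@bin_ext n r))
    (B : {set 'I_n}) (j : 'I_r) :
  t <= k -> weight x = t -> #|B| = k ->
  hamming x (block_word r B j.+1) = k + 1 - t <->
  supp x \subset B /\ (letter x = 0 \/ letter x = j.+1).
Proof.
have r_gt0 : 0 < r := leq_ltn_trans (leq0n j) (ltn_ord j).
move=> tk; rewrite weightE hammingE supp_block_word // letter_block_word //.
move=> wx cB; rewrite -setD_eq0 -cards_eq0.
have := card_symdiff _ (supp x) B; have := cardsID B (supp x).
by move: wx; rewrite cB; move: (letter x) => l; lia.
Qed.

Theorem theorem12 (t k n r : nat) (Sb : {set {set 'I_n}})
    (T : 'I_r -> {set {set 'I_n}})
    (ht : 1 <= t) (htk : t <= k) (hkn : k <= n)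
    (hS : steiner_system t k Sb)
    (hTinj : injective T)
    (hTpart : partition [set T j | j : 'I_r] Sb)
    (hT : forall j : 'I_r, steiner_system (t - 1) k (T j)) :
  mixed_steiner_system t (k + 1) (extended_words T).
Proof.
have memS B : B \in Sb <-> exists j, B \in T j.
  rewrite -(cover_partition hTpart); split.
    by case/bigcupP=> _ /imsetP[j _ ->] BT; exists j.
  by case=> j BT; apply/bigcupP; exists (T j) => //; apply: imset_f.
(* The partition only identifies the parts as sets; injectivity of [T] passes to the indices. *)
have T_uniq B i j : B \in T i -> B \in T j -> i = j.
  move=> Bi Bj; apply: hTinj; have /and3P[_ tI _] := hTpart.
  have TP l : T l \in [set T j | j : 'I_r] by apply: imset_f.
  by rewrite -(def_pblock tI (TP i) Bi) -(def_pblock tI (TP j) Bj).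
have cardT B j : B \in T j -> #|B| = k by case: (hT j) => + _; apply.
(* As [t <= n], some [t]-set exists; the block covering it lies in a part, whose index witnesses
   [0 < r]. *)
have r_gt0 : 0 < r.
  have [|A _ cA] := @exists_subset_card _ [set: 'I_n] t.
    by rewrite cardsT card_ord (leq_trans htk).
  case: hS => _ /(_ A cA) [B [[/memS[j _] _] _]].
  exact: leq_ltn_trans (leq0n j) (ltn_ord j).
split.
- by move=> i; rewrite /bin_ext; case: split.
- by rewrite ht; split; lia.
- move=> c /extended_wordsP[j [B [BT ->]]].
  by rewrite weightE supp_block_word // letter_block_word // (cardT _ _ BT).
- move=> x wx.
  (* Uniqueness is asked of the block alone: by [T_uniq] the block determines its part, hence the
     letter. *)
  suff [j [B [BT sB lB uB]]] : exists j B, [/\ B \in T j, supp x \subset B,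
      letter x = 0 \/ letter x = j.+1 & forall i C, C \in T i ->
      supp x \subset C -> letter x = 0 \/ letter x = i.+1 -> C = B].
    exists (block_word r B j.+1); split.
      split; first by apply/extended_wordsP; exists j, B.
      by apply/(hamming_block_word _ _ _ _ _ _ _ htk wx (cardT _ _ BT)).
    move=> _ [/extended_wordsP[i [C [CT ->]]]].
    case/(hamming_block_word _ _ _ _ _ _ _ htk wx (cardT _ _ CT)) => sC lC.
    have CB := uB i C CT sC lC; rewrite CB in CT *.
    by rewrite (T_uniq _ _ _ BT CT).
  move: wx; rewrite weightE; case lx: (letter x) => [|a] /= wx.
    rewrite addn0 in wx; case: hS => _ /(_ _ wx)[B [[/memS[j BT] sB] uB]].
    exists j, B; split=> //; first by left.
    by move=> i C CT sC _; rewrite -(uB C) //; split=> //; apply/memS; exists i.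
  have ar : a < r by rewrite -lx letter_le.
  have cA : #|supp x| = t - 1 by rewrite -wx addnK.
  case: (hT (Ordinal ar)) => _ /(_ _ cA)[B [[BT sB] uB]].
  exists (Ordinal ar), B; split=> //; first by right.
  move=> i C CT sC [//|[ai]].
  have ij : i = Ordinal ar by apply: val_inj.
  by rewrite ij in CT; rewrite -(uB C).
- move=> _ _ /extended_wordsP[i [B [BT ->]]] /extended_wordsP[j [C [CT ->]]] neq.
  rewrite hammingE !supp_block_word // !letter_block_word //.
  have := card_symdiff _ B C; rewrite (cardT _ _ BT) (cardT _ _ CT).
  case: (eqVneq i j) => [ij|ij].
    subst j; have BC : B <> C by move=> BC; apply: neq; rewrite BC.
    (* For [t = 1] the bound reads [< 0], a contradiction: a part then has a single block. *)
    have := steiner_meet _ _ _ _ _ _ (hT i) BT CT BC; lia.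
  have BC : B <> C by move=> BC; case/eqP: ij; apply: (T_uniq B) => //; rewrite BC.
  have BS : B \in Sb by apply/memS; exists i.
  have CS : C \in Sb by apply/memS; exists j.
  (* The supports contribute at least [2 * (k - t) + 2], and the differing letters give the last
     unit of [2 * (k + 1 - t) + 1]. *)
  have := steiner_meet _ _ _ _ _ _ hS BS CS BC.
  by rewrite eqSS (inj_eq val_inj) ij; lia.
Qed.
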